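(* Let $a,b$ be real numbers with $1<a<b$. Then $$\pi=\frac{\dfrac{b^2}{b^2+1}\,K\!\left(\dfrac{(a^2+1)b}{(b^2+1)a}\right)+\dfrac{b^2}{b^2-1}\,K\!\left(\dfrac{(a^2-1)b}{(b^2-1)a}\right)}{F_D^{(3)}\!\left(\tfrac12;\tfrac12,\tfrac12,\tfrac12;1\,\Big|\,\dfrac{a^2}{b^2},\dfrac{1}{a^2b^2},\dfrac{1}{b^4}\right)}.$$
   Context: $K(k)=\int_0^1\frac{dx}{\sqrt{(1-x^2)(1-k^2x^2)}}$ is the complete elliptic integral of the first kind, as a function of the modulus $k$. The Lauricella function of $n$ variables is $F_D^{(n)}(\alpha;\beta_1,\dots,\beta_n;\gamma\,|\,x_1,\dots,x_n)=\sum_{m_1,\dots,m_n\ge0}\frac{(\alpha)_{m_1+\cdots+m_n}(\beta_1)_{m_1}\cdots(\beta_n)_{m_n}}{(\gamma)_{m_1+\cdots+m_n}\,m_1!\cdots m_n!}x_1^{m_1}\cdots x_n^{m_n}$ for $|x_j|<1$, with $(x)_k$ the Pochhammer symbol. For $\operatorname{Re}\gamma>\operatorname{Re}\alpha>0$ it equals, and outside the region of convergence is defined by analytic continuation through, $\frac{\Gamma(\gamma)}{\Gamma(\alpha)\Gamma(\gamma-\alpha)}\int_0^1\frac{u^{\alpha-1}(1-u)^{\gamma-\alpha-1}}{(1-x_1u)^{\beta_1}\cdots(1-x_nu)^{\beta_n}}\,du$ (principal branches, $x_j\notin[1,\infty)$). *)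

(* Defs.v *)
From mathcomp Require Import all_boot all_order all_algebra.
From mathcomp Require Import all_classical all_reals all_analysis.
From mathcomp.analysis.showcase Require summability.
Import Order.TTheory GRing.Theory Num.Theory.
Import numFieldNormedType.Exports.

Set Implicit Arguments.
Unset Strict Implicit.
Unset Printing Implicit Defensive.

Local Open Scope classical_set_scope.
Local Open Scope ring_scope.

(* The argument k is the modulus (not the parameter k^2). At x = 1 the
   integrand takes the conventional value 0^-1 = 0, on a null set. The integral
   is finite for |k| < 1. *)
Definition ellipticK (R : realType) (k : R) : R :=
  \int[lebesgue_measure]_(x in `[0%R, 1%R])
    (Num.sqrt ((1 - x ^+ 2) * (1 - k ^+ 2 * x ^+ 2)))^-1.

Definition pochhammer (K : nzRingType) (x : K) (k : nat) : K :=
  \prod_(i < k) (x + i%:R).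

Definition lauricella_term (K : numFieldType) (n : nat) (alpha : K)
    (beta : n.-tuple K) (gamma : K) (x : n.-tuple K)
    (m : {ffun 'I_n -> nat}) : K :=
  pochhammer alpha (\sum_(j < n) m j)%N
    * (\prod_(j < n) pochhammer (tnth beta j) (m j))
    / (pochhammer gamma (\sum_(j < n) m j)%N * \prod_(j < n) (m j)`!%:R)
    * \prod_(j < n) tnth x j ^+ m j.

(* Unordered sum over all multi-indices, i.e. the limit of the finite partial
   sums along the directed set of finite sets of multi-indices. Only the power
   series is covered: the value is meaningful when |x_j| < 1 for all j and gamma
   is not a non-positive integer; no analytic continuation is built in. *)
Definition lauricellaFD (K : numFieldType) (n : nat) (alpha : K)
    (beta : n.-tuple K) (gamma : K) (x : n.-tuple K) : K :=
  summability.sum (R := K^o) (lauricella_term alpha beta gamma x).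

(* Main.v *)
Require Import Defs.
From mathcomp Require Import all_boot all_order all_algebra ring lra finmap.
From mathcomp Require Import all_classical all_reals all_analysis measurable_realfun.
Import Order.TTheory GRing.Theory Num.Theory.
Import numFieldNormedType.Exports.

Local Open Scope classical_set_scope.
Local Open Scope ring_scope.

(** The function [F_D] of the denominator is, by Euler's formula at these
    parameters, [2 / pi] times the integral over [[0, pi / 2]] of
    [V t = ((1 - x1 s^2) (1 - x2 s^2) (1 - x3 s^2)) ^ (-1/2)], where
    [s = sin t] and [x1, x2, x3] are its three arguments
    ([lauricellaFD_half]). This is an integral on the genus two curve
    [y^2 = u (1 - u) (1 - x1 u) (1 - x2 u) (1 - x3 u)].

    Because [x3 = x1 x2], that curve has the extra involution
    [u |-> b^4 / u]: it exchanges 0 with infinity, 1 with [1 / x3], and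
    [1 / x1] with [1 / x2]. With [w = u / b^2] this is [w |-> 1 / w], and the two
    quotients of the curve are elliptic, with coordinates [w^(-1/2) + w^(1/2)]
    and [w^(-1/2) - w^(1/2)]. Normalizing these coordinates gives
    the substitutions [x = (b^2 + e) s / (b^2 + e s^2)], [e = 1] or [e = -1], in
    the integral defining [K]. They show that
    [b^2 / (b^2 + e) * K k_e] is the integral of [(1 - e s^2 / b^2) V t]
    ([ellipticK_jacobi]). Adding the two cases removes the [e] term
    and leaves twice the integral of [V], that is [pi * F_D]; finally [F_D]
    is nonzero since [V] is at least 1.

    The formula for [F_D] is obtained termwise. The binomial series of
    [(1 - y) ^ (-1/2)] ([cvg_invsqrt_psum]) expands each factor of [V], Wallis'
    formula ([Rintegral_sin_expr_even]) integrates the monomials, and positivity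
    of all terms justifies both the exchange of limit and integral and
    the evaluation of the unordered sum along boxes ([sum_ge0_exhaustion]). *)

(** * Integration by substitution for a nonnegative improper integrand *)

Lemma bigcup_itvcc_co (R : realType) (a b : R) (t : R^nat) :
  (forall n, t n < b) -> t @ \oo --> b ->
  \bigcup_n `[a, t n]%classic = `[a, b[%classic.
Proof.
move=> tb tcvg; apply/seteqP; split=> x.
  case=> n _; rewrite /= !in_itv/= => /andP[-> xt] /=.
  exact: le_lt_trans xt (tb n).
rewrite /= in_itv/= => /andP[ax xb].
have [n _ /(_ n (leqnn n)) xt] := cvgr_ge _ tcvg _ xb.
by exists n => //=; rewrite in_itv/= ax xt.
Qed.

Lemma ge0_cvg_integral_itvco (R : realType) (a b : R) (t : R^nat)
    (f : R -> R) :
  nondecreasing_seq t -> (forall n, t n < b) -> t @ \oo --> b ->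
  (forall x, x \in `[a, b[ -> 0 <= f x) -> measurable_fun `[a, b[ f ->
  (\int[lebesgue_measure]_(x in `[a, t n]) (f x)%:E @[n --> \oo] -->
   \int[lebesgue_measure]_(x in `[a, b[) (f x)%:E)%E.
Proof.
move=> tnd tb tcvg f0 mf.
rewrite -(bigcup_itvcc_co _ _ _ _ tb tcvg).
have sub n : `[a, t n]%classic `<=` `[a, b[%classic.
  by rewrite -(bigcup_itvcc_co _ _ _ _ tb tcvg) => x xn; exists n.
apply: ge0_nondecreasing_set_cvg_integral.
- move=> m n mn; rewrite subsetEset => x /=; rewrite !in_itv/=.
  by move=> /andP[-> xt] /=; exact: le_trans xt (tnd _ _ mn).
- by move=> n; exact: measurable_itv.
- move=> n; apply/measurable_EFinP.
  by apply: (measurable_funS _ (sub n) mf); exact: measurable_itv.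
- by move=> n x /sub xab; rewrite lee_fin f0.
Qed.

(** The substitution theorem for continuous integrands on a compact interval
    does not cover [G] unbounded at the right end-point, which is how the
    elliptic integrand behaves. It is applied on [[a, t n]] with [t n]
    increasing to [b]; both sides then converge by monotone convergence along
    the exhausting intervals, since [G] is nonnegative. The right-hand interval
    is half-open because [G (F b)] need not be meaningful. *)
Lemma improper_integration_by_substitution (R : realType) (a b : R)
    (F f G : R -> R) :
  a < b -> (forall x : R, is_derive x 1 F (f x)) -> continuous f ->
  (forall x, x \in `[a, b[ -> 0 < f x) ->
  {in `[F a, F b[, continuous G} ->
  (forall x, x \in `[F a, F b[ -> 0 <= G x) ->
  (\int[lebesgue_measure]_(x in `[F a, F b]) (G x)%:E =
   \int[lebesgue_measure]_(x in `[a, b[) (G (F x) * f x)%:E)%E.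
Proof.
move=> ab dF cf f_gt0 cG G0.
have F'E : derive1 F = f by apply/funext => x; rewrite derive1E derive_val.
have dvF x : derivable F x 1 by case: (dF x).
have cF : continuous F.
  by move=> x; apply: differentiable_continuous; apply/derivable1_diffP.
have F_lt : {in `[a, b] &, {homo F : x y / x < y}}.
  apply: gtr0_derive1_lt_cc => [x _|x xab|]; first exact: dvF.
  - by rewrite F'E f_gt0 ?(subset_itv_oo_co xab).
  - exact: continuous_subspaceT.
have aab : a \in `[a, b] by rewrite in_itv/= lexx ltW.
have bab : b \in `[a, b] by rewrite in_itv/= lexx ltW.
have F_itv : forall x, x \in `[a, b[ -> F x \in `[F a, F b[.
  move=> x; rewrite in_itv/= => /andP[ax xb].
  have xab : x \in `[a, b] by rewrite in_itv/= ax ltW.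
  rewrite in_itv/= F_lt// andbT.
  by move: ax; rewrite le_eqVlt => /predU1P[->//|ax]; rewrite ltW// F_lt.
pose t n := b - (b - a) / n.+1%:R.
have t_lt n : t n < b by rewrite /t ltrBlDr ltrDl divr_gt0 ?subr_gt0.
have t_ge n : a <= t n.
  rewrite /t lerBrDr -lerBrDl ler_pdivrMr ?ltr0n//.
  by rewrite ler_peMr ?ler1n// subr_ge0 ltW.
have t_nd : nondecreasing_seq t.
  move=> m n mn; rewrite /t lerB// ler_wpM2l ?subr_ge0 ?(ltW ab)//.
  by rewrite lef_pV2 ?posrE ?ltr0n// ler_nat.
have t_cvg : t @ \oo --> b.
  rewrite -[X in _ --> X](subr0 b); apply: cvgB; first exact: cvg_cst.
  rewrite -[X in _ --> X](mulr0 (b - a)); apply: cvgM; first exact: cvg_cst.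
  exact: cvg_harmonic.
have t_in n : t n \in `[a, b[ by rewrite in_itv/= t_ge t_lt.
have Ft_nd : nondecreasing_seq (F \o t).
  move=> m n mn /=; have := t_nd _ _ mn.
  rewrite le_eqVlt => /predU1P[->//|tt]; apply/ltW/F_lt => //;
    exact: subset_itv_co_cc.
have Ft_lt n : (F \o t) n < F b.
  by have := F_itv _ (t_in n); rewrite in_itv/= => /andP[].
have Ft_cvg : F \o t @ \oo --> F b by apply: continuous_cvg t_cvg; exact: cF.
have mG : measurable_fun `[F a, F b[ G.
  apply: subspace_continuous_measurable_fun; first exact: measurable_itv.
  by apply: continuous_in_subspaceT => x; rewrite inE; exact: cG.
have GFf0 x : x \in `[a, b[ -> 0 <= G (F x) * f x.
  by move=> xab; rewrite mulr_ge0// ?G0 ?F_itv// ltW// f_gt0.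
have mGFf : measurable_fun `[a, b[ (fun x => G (F x) * f x).
  apply: subspace_continuous_measurable_fun; first exact: measurable_itv.
  apply: continuous_in_subspaceT => x; rewrite inE => xab.
  apply: cvgM; last exact: cf.
  by apply: continuous_comp; [exact: cF | exact/cG/F_itv].
rewrite -integral_itv_bndo_bndc; last exact/measurable_EFinP.
have := ge0_cvg_integral_itvco _ _ _ _ _ Ft_nd Ft_lt Ft_cvg G0 mG.
have := ge0_cvg_integral_itvco _ _ _ _ _ t_nd t_lt t_cvg GFf0 mGFf.
move=> lim2 lim1; apply: cvg_unique lim1 _; first exact: ereal_hausdorff.
suff : (fun n => \int[lebesgue_measure]_(x in `[F a, (F \o t) n]) (G x)%:E)%E =
  (fun n => \int[lebesgue_measure]_(x in `[a, t n]) (G (F x) * f x)%:E)%E.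
  by move=> ->.
apply/funext => n /=.
have sub_itv : {subset `[a, t n] <= `[a, b]}.
  move=> x; rewrite !in_itv/= => /andP[-> xt] /=.
  exact: le_trans xt (ltW (t_lt n)).
rewrite (@integration_by_substitution_increasing R F G a (t n) (t_ge n)).
- by under eq_integral do rewrite F'E.
- by move=> x y /sub_itv xab /sub_itv yab; exact: F_lt.
- by move=> x _; rewrite F'E; exact: cf.
- by rewrite F'E; apply/cvg_ex; exists (f a); exact/cvg_at_right_filter/cf.
- by rewrite F'E; apply/cvg_ex; exists (f (t n)); exact/cvg_at_left_filter/cf.
- split; first by move=> x _; exact: dvF.
  + exact/cvg_at_right_filter/cF.
  + exact/cvg_at_left_filter/cF.
apply: continuous_in_subspaceT => x; rewrite inE => xab; apply: cG.
move: xab; rewrite /= !in_itv/= => /andP[-> xt] /=.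
exact: le_lt_trans xt (Ft_lt n).
Qed.

(** * The binomial series of the inverse square root *)

(** The Taylor coefficients of [(1 - y) ^ (-1/2)] at 0. *)
Definition invsqrt_coef (R : numFieldType) (m : nat) : R :=
  pochhammer (1 / 2) m / m`!%:R.

Lemma pochhammerS (K : nzRingType) (x : K) m :
  pochhammer x m.+1 = pochhammer x m * (x + m%:R).
Proof. by rewrite /pochhammer big_ord_recr. Qed.

Lemma pochhammer1 (K : nzRingType) m : pochhammer (1 : K) m = m`!%:R.
Proof.
elim: m => [|m IHm]; first by rewrite /pochhammer big_ord0.
by rewrite pochhammerS IHm factS mulnC natrM [in RHS]mulrS.
Qed.

Lemma invsqrt_coef0 (R : numFieldType) : invsqrt_coef R 0 = 1.
Proof. by rewrite /invsqrt_coef /pochhammer big_ord0 fact0 divr1. Qed.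

Lemma invsqrt_coefS (R : numFieldType) m :
  m.+1%:R * invsqrt_coef R m.+1 = (m%:R + 1 / 2) * invsqrt_coef R m.
Proof.
rewrite /invsqrt_coef pochhammerS factS natrM.
have m1 : m.+1%:R != 0 :> R by rewrite pnatr_eq0.
have mf : m`!%:R != 0 :> R by rewrite pnatr_eq0 -lt0n fact_gt0.
move: m1 mf; rewrite -natr1; move: (m`!%:R : R) => f m1 mf.
by field; rewrite m1 mf.
Qed.

Lemma invsqrt_coef_ge0 (R : numFieldType) m : 0 <= invsqrt_coef R m.
Proof.
by apply: divr_ge0 => //; apply: prodr_ge0 => i _; apply: addr_ge0.
Qed.

(** The coefficient form of [((1 - y) ^ (-1/2)) ^ 2 = 1 / (1 - y)]. With [S n]
    the convolution and [T n] the same sum weighted by the index, the symmetry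
    [i <-> n - i] gives [2 T n = n S n], while the recurrence
    [(i + 1) c_(i+1) = (i + 1/2) c_i] gives [T (n + 1) = T n + S n / 2].
    Together they force [S (n + 1) = S n]. *)
Lemma invsqrt_coef_conv (R : numFieldType) n :
  \sum_(i < n.+1) invsqrt_coef R i * invsqrt_coef R (n - i) = 1.
Proof.
pose c := invsqrt_coef R.
pose S n : R := \sum_(i < n.+1) c i * c (n - i)%N.
pose T n : R := \sum_(i < n.+1) i%:R * (c i * c (n - i)%N).
have TS m : T m + T m = m%:R * S m.
  rewrite {2}/T (reindex_inj rev_ord_inj)/= -big_split/= mulr_sumr.
  apply: eq_bigr => i _; rewrite subSS subKn ?leq_ord// (mulrC (c (m - i)%N)).
  by rewrite -mulrDl -natrD subnKC ?leq_ord.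
have TSS m : T m.+1 = T m + 1 / 2 * S m.
  rewrite {1}/T big_ord_recl mul0r add0r mulr_sumr -big_split/=.
  apply: eq_bigr => i _.
  by rewrite /bump/= add1n subSS mulrA invsqrt_coefS /c; ring.
rewrite -/(S n); elim: n => [|n IHn].
  by rewrite /S big_ord1 subn0 /c invsqrt_coef0 mulr1.
have := TS n.+1; rewrite TSS IHn addrACA TS IHn => E.
apply: (@mulfI _ n.+1%:R); first by rewrite pnatr_eq0.
by rewrite -E -natr1; field.
Qed.

Definition invsqrt_psum (R : numFieldType) N (y : R) : R :=
  \sum_(i < N) invsqrt_coef R i * y ^+ i.

(** Squaring a truncation of a series with nonnegative coefficients: the square
    has the exact coefficient 1 in degrees below [N], coefficients between 0
    and 1 beyond, and none from degree [2 N] on. *)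
Lemma invsqrt_psum_sqr (R : numFieldType) N (y : R) : 0 <= y ->
  \sum_(n < N) y ^+ n <= invsqrt_psum _ N y ^+ 2 <= \sum_(n < N + N) y ^+ n.
Proof.
move=> y0; pose c := invsqrt_coef R; pose p := \poly_(i < N) c i.
have -> : invsqrt_psum _ N y ^+ 2 = \sum_(n < N + N) (p * p)`_n * y ^+ n.
  rewrite -horner_coef_wide; last first.
    apply: leq_trans (size_polyMleq _ _) _; apply: leq_trans (leq_pred _) _.
    by rewrite leq_add// size_poly.
  by rewrite hornerM horner_poly expr2.
have c0 := invsqrt_coef_ge0 R.
have p_le i : 0 <= p`_i <= c i by rewrite coef_poly; case: ifP; rewrite ?c0 ?lexx.
have pp0 n : 0 <= (p * p)`_n.
  rewrite coefM sumr_ge0// => i _.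
  by apply: mulr_ge0; have /andP[] := p_le i; have /andP[] := p_le (n - i)%N.
have pp1 n : (p * p)`_n <= 1.
  rewrite coefM -(invsqrt_coef_conv R n) ler_sum// => i _.
  have /andP[? ?] := p_le i; have /andP[? ?] := p_le (n - i)%N.
  by rewrite ler_pM.
have ppE n : (n < N)%N -> (p * p)`_n = 1.
  move=> nN; rewrite coefM -(invsqrt_coef_conv R n); apply: eq_bigr => i _.
  rewrite !coef_poly (leq_ltn_trans (leq_ord i) nN).
  by rewrite (leq_ltn_trans (leq_subr _ _) nN).
apply/andP; split; last first.
  by apply: ler_sum => n _; rewrite ler_piMl ?exprn_ge0.
rewrite big_split_ord/= ler_wpDr//.
  by apply: sumr_ge0 => i _; rewrite mulr_ge0 ?exprn_ge0.
by apply: ler_sum => n _; rewrite ppE ?mul1r.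
Qed.

Lemma invsqrt_psum_ge0 (R : numFieldType) N (y : R) : 0 <= y ->
  0 <= invsqrt_psum _ N y.
Proof.
by move=> y0; apply: sumr_ge0 => i _; rewrite mulr_ge0 ?exprn_ge0 ?invsqrt_coef_ge0.
Qed.

Lemma nondecreasing_invsqrt_psum (R : numFieldType) (y : R) : 0 <= y ->
  nondecreasing_seq (fun N => invsqrt_psum _ N y).
Proof.
move=> y0; apply/nondecreasing_seqP => N.
by rewrite /invsqrt_psum big_ord_recr/= lerDl mulr_ge0 ?exprn_ge0 ?invsqrt_coef_ge0.
Qed.

(** The binomial series, without differentiating a power series: the squares of
    the partial sums are squeezed between two geometric sums that tend to
    [1 / (1 - y)], and the partial sums are nonnegative. *)
Lemma cvg_invsqrt_psum (R : realType) (y : R) : 0 <= y -> y < 1 ->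
  invsqrt_psum _ N y @[N --> \oo] --> (Num.sqrt (1 - y))^-1.
Proof.
move=> y0 y1.
have geo : (fun N => \sum_(n < N) y ^+ n) @ \oo --> (1 - y)^-1.
  have := @cvg_geometric_series R 1 y; rewrite ger0_norm// mul1r => /(_ y1).
  apply: cvg_trans; apply: near_eq_cvg; near=> N.
  rewrite /series/= /geometric big_mkord/=.
  by apply: eq_bigr => i _; rewrite mul1r.
have geo2 : (fun N => \sum_(n < N + N) y ^+ n) @ \oo --> (1 - y)^-1.
  apply: (cvg_comp (fun N => N + N)%N _ _ geo).
  apply/cvgnyPge => A; near=> N; apply: (leq_trans _ (leq_addr _ _)).
  by near: N; exact: nbhs_infty_ge.
have sq : invsqrt_psum _ N y ^+ 2 @[N --> \oo] --> (1 - y)^-1.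
  apply: squeeze_cvgr geo geo2; near=> N; exact: invsqrt_psum_sqr.
rewrite -sqrtrV ?subr_ge0 1?ltW//.
have -> : (fun N => invsqrt_psum _ N y) =
    (fun N => Num.sqrt (invsqrt_psum _ N y ^+ 2)).
  by apply/funext => N; rewrite sqrtr_sqr ger0_norm ?invsqrt_psum_ge0.
by apply: continuous_cvg sq; exact: sqrt_continuous.
Unshelve. all: by end_near. Qed.

(** * Wallis integrals and unordered sums of nonnegative terms *)

Lemma continuous_integrable_itvcc (R : realType) (a b : R) (f : R -> R) :
  continuous f ->
  lebesgue_measure.-integrable `[a, b]%classic (EFin \o f).
Proof.
move=> cf; apply: continuous_compact_integrable; first exact: segment_compact.
exact: continuous_subspaceT.
Qed.

Lemma continuous_sin2 (R : realType) : continuous (fun t : R => sin t ^+ 2).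
Proof.
move=> t; apply: (@continuous_comp _ _ _ sin (fun x : R => x ^+ 2)).
  exact: continuous_sin.
exact: exprn_continuous.
Qed.

Lemma continuous_sin2X (R : realType) k :
  continuous (fun t : R => (sin t ^+ 2) ^+ k).
Proof.
move=> t; apply: (@continuous_comp _ _ _ (fun t : R => sin t ^+ 2)
  (fun x : R => x ^+ k)).
  exact: continuous_sin2.
exact: exprn_continuous.
Qed.

Lemma continuous_sumr (R : realType) (I : Type) (r : seq I)
    (f : I -> R -> R) :
  (forall i, continuous (f i)) -> continuous (fun t => \sum_(i <- r) f i t).
Proof. by move=> cf; apply: continuous_big => //; exact: add_continuous. Qed.

Lemma continuous_prodr (R : realType) (I : Type) (r : seq I)
    (f : I -> R -> R) :
  (forall i, continuous (f i)) -> continuous (fun t => \prod_(i <- r) f i t).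
Proof. by move=> cf; apply: continuous_big => //; exact: mul_continuous. Qed.

Lemma Rintegral_sum_itvcc (R : realType) (I : Type) (r : seq I)
    (f : I -> R -> R) (a b : R) :
  (forall i, continuous (f i)) ->
  \int[lebesgue_measure]_(t in `[a, b]) (\sum_(i <- r) f i t) =
  \sum_(i <- r) \int[lebesgue_measure]_(t in `[a, b]) f i t.
Proof.
move=> cf; elim: r => [|i r IHr].
  by rewrite big_nil; under eq_Rintegral do rewrite big_nil; rewrite Rintegral_cst ?mul0r.
rewrite big_cons -IHr -RintegralD//; last 2 first.
- exact: continuous_integrable_itvcc.
- exact/continuous_integrable_itvcc/continuous_sumr.
by under eq_Rintegral do rewrite big_cons.
Qed.

(** Wallis: the derivative of [sin ^ (2m+1) * cos] is
    [(2m+1) sin ^ (2m) - (2m+2) sin ^ (2m+2)] and this function vanishes at both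
    ends of [[0, pi / 2]], so the integrals obey the recurrence of
    [invsqrt_coef]. *)
Lemma Rintegral_sin_expr_even (R : realType) m :
  \int[lebesgue_measure]_(t in `[0, pi / 2]) ((sin t ^+ 2) ^+ m) =
  pi / 2 * invsqrt_coef R m.
Proof.
have pi2 : 0 < pi / 2 :> R by rewrite divr_gt0 ?pi_gt0.
have cs2 := @continuous_sin2X R.
elim: m => [|m IHm].
  under eq_Rintegral do rewrite expr0.
  rewrite Rintegral_cst// invsqrt_coef0 mul1r mulr1.
  by have := lebesgue_measure_itv (`[0, pi / 2] : interval R); rewrite /= lte_fin pi2 => ->; rewrite /= subr0.
pose F (t : R) := sin t ^+ m.*2.+1 * cos t.
pose f (t : R) := m.*2.+1%:R * (sin t ^+ 2) ^+ m - m.*2.+2%:R * (sin t ^+ 2) ^+ m.+1.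
have cf : continuous f.
  move=> t; apply: cvgB; (apply: cvgM; [exact: cvg_cst|exact: cs2]).
have dF (t : R) : is_derive t 1 F (f t).
  have -> : F = (sin : R -> R) ^+ m.*2.+1 * cos.
    by apply/funext => x; rewrite /F fctE/= exprfctE.
  apply: is_derive_eq.
  rewrite /f exprfctE -mul2n [_.-1]/= exprS !exprM [_ ^+ m.+1]exprS /GRing.scale/=.
  have -> (x y z : R) : x * (y * z * x) = y * z * x ^+ 2 by ring.
  rewrite cos2sin2 -![_.+1%:R]natr1.
  by move: ((_ ^+ 2) ^+ m) => P; ring.
have F'E : derive1 F = f by apply/funext => x; rewrite derive1E derive_val.
have dvF x : derivable F x 1 by case: (dF x).
have cF : continuous F.
  by move=> x; apply: differentiable_continuous; apply/derivable1_diffP.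
have : (\int[lebesgue_measure]_(t in `[0%R, (pi / 2)%R]) (f t)%:E = (F (pi / 2))%:E - (F 0)%:E)%E.
  apply: continuous_FTC2 => //.
  - exact: continuous_subspaceT.
  - by split=> [x _| |]; [exact: dvF | exact/cvg_at_right_filter/cF | exact/cvg_at_left_filter/cF].
  - by move=> x _; rewrite F'E.
rewrite /F cos_pihalf mulr0 sin0 expr0n/= mul0r subee// => /(congr1 fine) /=.
rewrite -/(Rintegral _ _ _) RintegralB//; last 2 first.
- apply: continuous_integrable_itvcc => t; apply: cvgM; [exact: cvg_cst|exact: cs2].
- apply: continuous_integrable_itvcc => t; apply: cvgM; [exact: cvg_cst|exact: cs2].
rewrite !RintegralZl//; try exact: continuous_integrable_itvcc.
rewrite IHm => /eqP; rewrite subr_eq0 => /eqP E.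
apply: (@mulfI _ m.*2.+2%:R); first by rewrite pnatr_eq0.
rewrite -E mulrCA [RHS]mulrCA; congr (_ * _).
rewrite -doubleS -!mul2n -addn1 !natrD !natrM -mulrA invsqrt_coefS; by field.
Qed.

Lemma ler_sum_fset (R : realDomainType) (I : choiceType) (u : I -> R)
    (B C : {fset I}) :
  (forall i, 0 <= u i) -> (B `<=` C)%fset ->
  \sum_(i <- B) u i <= \sum_(i <- C) u i.
Proof.
move=> u0 BC; rewrite [leRHS](big_fsetID _ (mem B))/=.
have -> : [fset x in C | x \in B]%fset = B.
  by apply/fsetP => x; rewrite !inE/= andb_idl// => /(fsubsetP BC).
by rewrite lerDl sumr_ge0.
Qed.

(** For nonnegative terms the limit over the directed set of all finite sets can
    be computed along any family [A N] that eventually captures each index: a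
    finite sum is at most the limit [l], and above some [A N] it is
    within any given distance of [l]. *)
Lemma sum_ge0_exhaustion (R : realType) (I : choiceType) (u : I -> R)
    (A : nat -> {fset I}) (l : R) :
  (forall i, 0 <= u i) -> (forall i, \forall N \near \oo, i \in A N) ->
  \sum_(i <- A N) u i @[N --> \oo] --> l ->
  summability.sum (R := R^o) u = l.
Proof.
move=> u0 exA Al.
have ub (B : {fset I}) : \sum_(i <- B) u i <= l.
  apply: (cvgr_to_ge Al).
  have : \forall N \near \oo, forall i : B, val i \in A N.
    by apply: filter_forall => i; exact: exA.
  apply: filterS => N BA; apply: ler_sum_fset => //.
  by apply/fsubsetP => i iB; exact: (BA [` iB]%fset).
have FF := @summability.totally_filter I.
apply: cvg_lim; first exact: norm_hausdorff.
apply/(@cvgrPdist_le _ _ _ _ FF) => e e0.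
have [N _ /(_ N (leqnn N)) AN] := (cvgrPdist_le _ _).1 Al e e0.
exists (A N) => // B /= AB.
have -> : summability.partial_sum u B = \sum_(i <- B) u i.
  by rewrite big_seq_fsetE.
rewrite ger0_norm ?subr_ge0//; apply: le_trans AN.
rewrite ger0_norm ?subr_ge0// lerB//; exact: ler_sum_fset.
Qed.

(** * Euler's integral for the Lauricella series at one half *)

(** The multi-indices with all entries below [N]; on this set a sum of products
    factors as a product of sums. *)
Definition multi_box (n N : nat) : {fset {ffun 'I_n -> nat}} :=
  [fset m in [seq [ffun j => val (g j)] | g : {ffun 'I_n -> 'I_N}]]%fset.

Lemma mem_multi_box n (m : {ffun 'I_n -> nat}) N :
  (forall j, (m j < N)%N) -> m \in multi_box n N.
Proof.
move=> mN; rewrite inE; apply/mapP.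
exists [ffun j => Ordinal (mN j)]; first by rewrite mem_enum.
by apply/ffunP => j; rewrite !ffunE.
Qed.

Lemma big_multi_box (R : zmodType) n N (F : {ffun 'I_n -> nat} -> R) :
  \sum_(m <- multi_box n N) F m =
  \sum_(g : {ffun 'I_n -> 'I_N}) F [ffun j => val (g j)].
Proof.
transitivity (\sum_(m <- [seq [ffun j => val (g j)] | g : {ffun 'I_n -> 'I_N}]) F m).
  apply: perm_big; apply: uniq_perm; first exact: fset_uniq.
  - rewrite map_inj_uniq ?enum_uniq// => g h /ffunP gh; apply/ffunP => j.
    by apply: val_inj; have := gh j; rewrite !ffunE.
  - by move=> m; rewrite inE.
by rewrite big_image.
Qed.

(** With [gamma = 1] the factor [(1)_M] is [M!], so the term is a product of
    binomial-series coefficients: one of total degree [M], which the Wallis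
    integral produces, and one for each variable. *)
Lemma lauricella_term_half (R : numFieldType) n (x : n.-tuple R)
    (m : {ffun 'I_n -> nat}) :
  lauricella_term (1 / 2) [tuple 1 / 2 | _ < n] 1 x m =
  invsqrt_coef R (\sum_(j < n) m j)%N *
  \prod_(j < n) (invsqrt_coef R (m j) * tnth x j ^+ m j).
Proof.
rewrite /lauricella_term pochhammer1 [in RHS]big_split/= /invsqrt_coef.
under [X in _ * X / _]eq_bigr do rewrite tnth_mktuple.
rewrite mulrA; congr (_ * _).
by rewrite prodf_div invfM mulrACA.
Qed.

(** Each box-truncated Lauricella sum is the integral of a product of truncated
    binomial series: expand the product by distributivity and integrate each
    monomial in [sin t ^+ 2] by Wallis. *)
Lemma sum_multi_box_lauricella (R : realType) n (x : n.-tuple R) N :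
  pi / 2 * \sum_(m <- multi_box n N)
    lauricella_term (1 / 2) [tuple 1 / 2 | _ < n] 1 x m =
  \int[lebesgue_measure]_(t in `[0, pi / 2])
    \prod_(j < n) invsqrt_psum R N (tnth x j * sin t ^+ 2).
Proof.
rewrite big_multi_box mulr_sumr.
transitivity (\int[lebesgue_measure]_(t in `[0, pi / 2 : R])
    \sum_(g : {ffun 'I_n -> 'I_N})
      (\prod_(j < n) (invsqrt_coef R (g j) * tnth x j ^+ g j) *
       (sin t ^+ 2) ^+ (\sum_(j < n) g j)%N)).
  rewrite Rintegral_sum_itvcc => [|g]; last first.
    by move=> t; apply: cvgM; [exact: cvg_cst | exact: continuous_sin2X].
  apply: eq_bigr => g _; rewrite RintegralZl//; last first.
    exact/continuous_integrable_itvcc/continuous_sin2X.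
  rewrite Rintegral_sin_expr_even lauricella_term_half.
  rewrite [RHS]mulrCA; congr (_ * _); rewrite [RHS]mulrC.
  by congr (invsqrt_coef R _ * _); apply: eq_bigr => j _; rewrite ffunE.
apply: eq_Rintegral => t _; rewrite bigA_distr_bigA/=.
apply: eq_bigr => g _.
rewrite -prodrXr -big_split/=; apply: eq_bigr => j _.
by rewrite [in RHS]exprMn mulrA.
Qed.

Lemma sin2_itv01 (R : realType) (t : R) : 0 <= sin t ^+ 2 <= 1.
Proof. by rewrite sqr_ge0 sin2cos2 lerBlDr lerDl sqr_ge0. Qed.

Lemma mul_sin2_itv01 (R : realType) (x t : R) : 0 <= x < 1 ->
  0 <= x * sin t ^+ 2 < 1.
Proof.
move=> /andP[x0 x1]; have /andP[s0 s1] := sin2_itv01 R t.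
by rewrite mulr_ge0//= (le_lt_trans _ x1)// ler_piMr.
Qed.

Lemma continuous_invsqrt_sin2 (R : realType) (x : R) : 0 <= x < 1 ->
  continuous (fun t : R => (Num.sqrt (1 - x * sin t ^+ 2))^-1).
Proof.
move=> x01 t; have /andP[_ xs1] := mul_sin2_itv01 R x t x01.
apply: cvgV; first by rewrite gt_eqF// sqrtr_gt0 subr_gt0.
apply: (@continuous_comp _ _ _ (fun t : R => 1 - x * sin t ^+ 2) Num.sqrt).
  apply: cvgB; first exact: cvg_cst.
  apply: cvgM; first exact: cvg_cst.
  exact: continuous_sin2.
exact: sqrt_continuous.
Qed.

(** Euler's integral for [F_D] at [alpha = beta_j = 1/2], [gamma = 1], written
    with [u = sin t ^+ 2], which turns the Beta weight
    [u ^ (-1/2) (1 - u) ^ (-1/2) du] into [2 dt]. The truncated products increase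
    to the integrand, so monotone convergence applies, and the unordered sum is
    computed along boxes. *)
Lemma lauricellaFD_half (R : realType) n (x : n.-tuple R) :
  (forall j, 0 <= tnth x j < 1) ->
  pi / 2 * lauricellaFD (1 / 2) [tuple 1 / 2 | _ < n] 1 x =
  \int[lebesgue_measure]_(t in `[0, pi / 2])
    \prod_(j < n) (Num.sqrt (1 - tnth x j * sin t ^+ 2))^-1.
Proof.
move=> x01.
have xs01 j (t : R) : 0 <= tnth x j * sin t ^+ 2 < 1 by exact: mul_sin2_itv01.
pose P N t := \prod_(j < n) invsqrt_psum R N (tnth x j * sin t ^+ 2).
pose V t := \prod_(j < n) (Num.sqrt (1 - tnth x j * sin t ^+ 2))^-1.
have P_ge0 N t : 0 <= P N t.
  by apply: prodr_ge0 => j _; apply: invsqrt_psum_ge0; have /andP[] := xs01 j t.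
have P_cvg t : P N t @[N --> \oo] --> V t.
  apply: cvg_big => [|j _]; first exact: mul_continuous.
  by have /andP[? ?] := xs01 j t; exact: cvg_invsqrt_psum.
have P_nd t : nondecreasing_seq (P ^~ t).
  move=> M N MN; apply: ler_prod => j _; have /andP[? _] := xs01 j t.
  by rewrite invsqrt_psum_ge0//= nondecreasing_invsqrt_psum.
have cP N : continuous (P N).
  apply: continuous_prodr => j; apply: continuous_sumr => i t.
  apply: cvgM; first exact: cvg_cst.
  apply: (@continuous_comp _ _ _ (fun t : R => tnth x j * sin t ^+ 2) (fun x : R => x ^+ _)).
    apply: cvgM; first exact: cvg_cst.
    exact: continuous_sin2.
  exact: exprn_continuous.
have cV : continuous V.
  by apply: continuous_prodr => j; exact: continuous_invsqrt_sin2.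
have : (\int[lebesgue_measure]_(t in `[0%R, (pi / 2)%R]) (P N t)%:E @[N --> \oo] -->
    \int[lebesgue_measure]_(t in `[0%R, (pi / 2)%R]) (V t)%:E)%E.
  have -> : (\int[lebesgue_measure]_(t in `[0%R, (pi / 2)%R]) (V t)%:E =
     \int[lebesgue_measure]_(t in `[0%R, (pi / 2)%R]) (limn (fun N => (P N t)%:E)))%E.
    apply: eq_integral => t _; apply/esym/cvg_lim; first exact: ereal_hausdorff.
    by apply: cvg_EFin; [exact: nearW | exact: P_cvg].
  apply: cvg_monotone_convergence => //.
  - move=> N; apply/measurable_EFinP/measurable_funTS.
    exact: continuous_measurable_fun.
  - by move=> N t _; rewrite lee_fin.
  - by move=> t _ M N MN; rewrite lee_fin P_nd.
have pi2 : pi / 2 != 0 :> R by rewrite gt_eqF// divr_gt0 ?pi_gt0.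
rewrite -[X in _ --> X -> _]fineK; last first.
  by apply: integrable_fin_num => //; exact: continuous_integrable_itvcc.
move=> /fine_cvg lim_int.
have lim_box : \sum_(m <- multi_box n N)
    lauricella_term (1 / 2) [tuple 1 / 2 | _ < n] 1 x m @[N --> \oo] -->
    (pi / 2)^-1 * \int[lebesgue_measure]_(t in `[0, pi / 2]) V t.
  have -> : (fun N => \sum_(m <- multi_box n N)
      lauricella_term (1 / 2) [tuple 1 / 2 | _ < n] 1 x m) =
      (fun N => (pi / 2)^-1 * \int[lebesgue_measure]_(t in `[0, pi / 2]) P N t).
    by apply/funext => N; rewrite -sum_multi_box_lauricella mulKf.
  by apply: cvgM; [exact: cvg_cst | exact: lim_int].
rewrite /lauricellaFD (sum_ge0_exhaustion _ _ _ _ _ _ _ lim_box) ?mulVKf//.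
- move=> m; rewrite lauricella_term_half mulr_ge0 ?invsqrt_coef_ge0//.
  apply: prodr_ge0 => j _; have /andP[? _] := x01 j.
  by rewrite mulr_ge0 ?exprn_ge0 ?invsqrt_coef_ge0.
- move=> m; near=> N; apply: mem_multi_box => j.
  apply: (@leq_trans (\sum_(i < n) m i).+1).
    by rewrite ltnS (bigD1 j)//= leq_addr.
  by near: N; exact: nbhs_infty_ge.
Unshelve. all: by end_near. Qed.

(** * Reduction of the elliptic integrals *)

(** The algebra behind the reduction. For [e = 1] and [e = -1] the map
    [s |-> x] fixes 0 and 1 and pulls the quartic under the square root
    in [K k] back to the degree-eight polynomial of the Lauricella integrand,
    up to a square:
    [1 - x^2] yields [1 - s^2] and [1 - s^2 / b^4], whereas [1 - k^2 x^2] yields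
    [1 - a^2 s^2 / b^2] and [1 - s^2 / (a^2 b^2)]. *)
Lemma modulus_identity (K : numFieldType) (a b e s : K) :
  e ^+ 2 = 1 -> a != 0 -> b != 0 -> b ^+ 2 + e != 0 ->
  b ^+ 2 + e * s ^+ 2 != 0 ->
  let x := (b ^+ 2 + e) * s / (b ^+ 2 + e * s ^+ 2) in
  let k := ((a ^+ 2 + e) * b) / ((b ^+ 2 + e) * a) in
  (1 - x ^+ 2) * (1 - k ^+ 2 * x ^+ 2) =
  (b ^+ 4 / (b ^+ 2 + e * s ^+ 2) ^+ 2) ^+ 2 * (1 - s ^+ 2) *
  ((1 - a ^+ 2 / b ^+ 2 * s ^+ 2) * (1 - 1 / (a ^+ 2 * b ^+ 2) * s ^+ 2) *
   (1 - 1 / b ^+ 4 * s ^+ 2)).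
Proof.
move=> /eqP; rewrite sqrf_eq1 => /orP[] /eqP-> a0 b0 be0 den0 x k.
  by rewrite /x /k; field; rewrite mul1r in den0; rewrite a0 b0 be0 den0.
by rewrite /x /k; field; rewrite a0 b0 be0 den0.
Qed.

Lemma is_derive_jacobi (R : realType) (p e t : R) :
  p + e * sin t ^+ 2 != 0 ->
  is_derive t 1 (fun u : R => (p + e) * sin u / (p + e * sin u ^+ 2))
    ((p + e) * (p - e * sin t ^+ 2) / (p + e * sin t ^+ 2) ^+ 2 * cos t).
Proof.
move=> den0.
pose g : R -> R := cst p + e *: (sin : R -> R) ^+ 2.
have g0 : g t != 0 by [].
have -> : (fun u : R => (p + e) * sin u / (p + e * sin u ^+ 2)) =
   ((p + e) *: (sin : R -> R)) * (fun u => (g u)^-1) by [].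
apply: is_derive_eq.
rewrite -/g (_ : g t = p + e * sin t ^+ 2)// (_ : (_ *: sin) t = (p + e) * sin t)//.
rewrite [_.-1]/= expr1 /GRing.scale/=.
by field.
Qed.

Lemma continuous_ellipticK_integrand (R : realType) (k x : R) :
  0 < (1 - x ^+ 2) * (1 - k ^+ 2 * x ^+ 2) ->
  {for x, continuous
    (fun y : R => (Num.sqrt ((1 - y ^+ 2) * (1 - k ^+ 2 * y ^+ 2)))^-1)}.
Proof.
move=> Dx; apply: cvgV; first by rewrite gt_eqF ?sqrtr_gt0.
apply: (@continuous_comp _ _ _
  (fun y : R => (1 - y ^+ 2) * (1 - k ^+ 2 * y ^+ 2)) Num.sqrt).
  have c2 : y ^+ 2 @[y --> x] --> x ^+ 2 by exact: exprn_continuous.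
  apply: cvgM; first by apply: cvgB => //; exact: cvg_cst.
  apply: cvgB; first exact: cvg_cst.
  by apply: cvgM => //; exact: cvg_cst.
exact: sqrt_continuous.
Qed.

Lemma lauricella_args_itv01 (R : realFieldType) (a b : R) : 1 < a -> a < b ->
  [/\ 0 <= a ^+ 2 / b ^+ 2 < 1, 0 <= 1 / (a ^+ 2 * b ^+ 2) < 1 &
      0 <= 1 / b ^+ 4 < 1].
Proof.
move=> a1 ab.
have a0 : 0 < a by lra.
have b0 : 0 < b by lra.
have a2 : 1 < a ^+ 2 by rewrite exprn_egt1.
have b2 : 1 < b ^+ 2 by rewrite exprn_egt1//; lra.
have inv_itv (y : R) : 1 < y -> 0 <= 1 / y < 1.
  move=> y1; have y0 : 0 < y by lra.
  by rewrite divr_ge0 ?ltW//= ltr_pdivrMr// mul1r.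
split.
- rewrite divr_ge0 ?sqr_ge0//= ltr_pdivrMr ?exprn_gt0// mul1r.
  by rewrite ltr_pXn2r ?nnegrE// ltW.
- by apply: inv_itv; rewrite (lt_trans a2)// ltr_pMr ?exprn_gt0.
- by apply: inv_itv; rewrite exprn_egt1//; lra.
Qed.

(** The substitution [x = (b^2 + e) s / (b^2 + e s^2)] with [s = sin t]. The factor
    [cos t] of [dx] cancels the one that [1 - s^2] contributes to the square
    root, so the transformed integrand is continuous up to [pi / 2]. The sign
    [e] survives only in the numerator [1 - e s^2 / b^2] coming from [dx],
    which is why the two choices of [e] can be added. *)
Lemma ellipticK_jacobi (R : realType) (a b e : R) :
  1 < a -> a < b -> e ^+ 2 = 1 ->
  b ^+ 2 / (b ^+ 2 + e) *
    ellipticK (((a ^+ 2 + e) * b) / ((b ^+ 2 + e) * a)) =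
  \int[lebesgue_measure]_(t in `[0, pi / 2])
    ((1 - e / b ^+ 2 * sin t ^+ 2) *
     ((Num.sqrt (1 - a ^+ 2 / b ^+ 2 * sin t ^+ 2))^-1 *
      (Num.sqrt (1 - 1 / (a ^+ 2 * b ^+ 2) * sin t ^+ 2))^-1 *
      (Num.sqrt (1 - 1 / b ^+ 4 * sin t ^+ 2))^-1)).
Proof.
move=> a1 ab e2.
have a0 : 0 < a by lra.
have b0 : 0 < b by lra.
have eN1 : -1 <= e <= 1.
  by move/eqP: e2; rewrite sqrf_eq1 => /orP[] /eqP->; lra.
have b2 : 1 < b ^+ 2 by nra.
have be0 : 0 < b ^+ 2 + e by lra.
have sin01 := sin2_itv01 R.
have den0 (t : R) : 0 < b ^+ 2 + e * sin t ^+ 2 by have := sin01 t; nra.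
have num0 (t : R) : 0 < b ^+ 2 - e * sin t ^+ 2 by have := sin01 t; nra.
set k := (a ^+ 2 + e) * b / ((b ^+ 2 + e) * a).
have k01 : 0 <= k < 1.
  have q0 : 0 < (b ^+ 2 + e) * a by rewrite mulr_gt0.
  rewrite /k ltr_pdivrMr// mul1r divr_ge0 ?(ltW q0)//=; last first.
    by rewrite mulr_ge0 ?(ltW b0)//; nra.
  have ab_gt0 : 0 < a * b - e by nra.
  by nra.
have [x1_itv x2_itv x3_itv] := lauricella_args_itv01 _ _ _ a1 ab.
pose F (t : R) := (b ^+ 2 + e) * sin t / (b ^+ 2 + e * sin t ^+ 2).
pose f (t : R) := (b ^+ 2 + e) * (b ^+ 2 - e * sin t ^+ 2) /
  (b ^+ 2 + e * sin t ^+ 2) ^+ 2 * cos t.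
pose G (x : R) := (Num.sqrt ((1 - x ^+ 2) * (1 - k ^+ 2 * x ^+ 2)))^-1.
pose V (t : R) := ((Num.sqrt (1 - a ^+ 2 / b ^+ 2 * sin t ^+ 2))^-1 *
      (Num.sqrt (1 - 1 / (a ^+ 2 * b ^+ 2) * sin t ^+ 2))^-1 *
      (Num.sqrt (1 - 1 / b ^+ 4 * sin t ^+ 2))^-1).
have pi2 : 0 < pi / 2 :> R by rewrite divr_gt0 ?pi_gt0.
have F0 : F 0 = 0 by rewrite /F sin0 mulr0 mul0r.
have F1 : F (pi / 2) = 1.
  by rewrite /F sin_pihalf expr1n !mulr1 divff ?gt_eqF.
have cos_gt0 (t : R) : t \in `[0, pi / 2[ -> 0 < cos t.
  by rewrite in_itv/= => /andP[t0 tpi]; apply: cos_gt0_pihalf; lra.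
have dF (t : R) : is_derive t 1 F (f t).
  by apply: is_derive_jacobi; rewrite gt_eqF.
have cf : continuous f.
  move=> t; apply: cvgM; last exact: continuous_cos.
  apply: cvgM.
    apply: cvgM; first exact: cvg_cst.
    apply: cvgB; first exact: cvg_cst.
    by apply: cvgM; [exact: cvg_cst | exact: continuous_sin2].
  apply: cvgV; first by rewrite expf_neq0// gt_eqF.
  apply: (@continuous_comp _ _ _ (fun t : R => b ^+ 2 + e * sin t ^+ 2) (fun x : R => x ^+ 2)).
    apply: cvgD; first exact: cvg_cst.
    by apply: cvgM; [exact: cvg_cst | exact: continuous_sin2].
  exact: exprn_continuous.
have f_gt0 (t : R) : t \in `[0, pi / 2[ -> 0 < f t.
  by move=> /cos_gt0 C0; rewrite /f mulr_gt0// divr_gt0 ?exprn_gt0// mulr_gt0.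
have D_gt0 (x : R) : x \in `[0, 1[ -> 0 < (1 - x ^+ 2) * (1 - k ^+ 2 * x ^+ 2).
  rewrite in_itv/= => /andP[x0 x1]; have /andP[k0 k1] := k01.
  rewrite mulr_gt0 ?subr_gt0//; first by rewrite expr_lt1.
  rewrite -exprMn expr_lt1 ?(mulr_ge0 k0)//.
  by rewrite (le_lt_trans _ x1)// ler_piMl// ltW.
have cG : {in `[0, 1[, continuous G}.
  by move=> x /D_gt0; exact: continuous_ellipticK_integrand.
have G0 (x : R) : x \in `[0, 1[ -> 0 <= G x by rewrite invr_ge0 sqrtr_ge0.
have := @improper_integration_by_substitution R 0 (pi / 2) F f G pi2 dF cf f_gt0.
rewrite F0 F1 => /(_ cG G0) subst.
rewrite /ellipticK /Rintegral {}subst.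
have GF (t : R) : t \in `[0, pi / 2[ ->
    G (F t) * f t = (b ^+ 2 + e) / b ^+ 2 * ((1 - e / b ^+ 2 * sin t ^+ 2) * V t).
  move=> /cos_gt0 C0.
  have C2 : 1 - sin t ^+ 2 = cos t ^+ 2 by rewrite cos2sin2.
  have x1_gt0 : 0 < 1 - a ^+ 2 / b ^+ 2 * sin t ^+ 2.
    by rewrite subr_gt0; have /andP[] := mul_sin2_itv01 R _ t x1_itv.
  have x2_gt0 : 0 < 1 - 1 / (a ^+ 2 * b ^+ 2) * sin t ^+ 2.
    by rewrite subr_gt0; have /andP[] := mul_sin2_itv01 R _ t x2_itv.
  have x3_gt0 : 0 < 1 - 1 / b ^+ 4 * sin t ^+ 2.
    by rewrite subr_gt0; have /andP[] := mul_sin2_itv01 R _ t x3_itv.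
  rewrite /G /F /k modulus_identity// ?gt_eqF// C2.
  rewrite -exprMn sqrtrM ?sqr_ge0// sqrtr_sqr ger0_norm; last first.
    by rewrite mulr_ge0 ?divr_ge0 ?exprn_ge0// ltW.
  rewrite sqrtrM ?(ltW (mulr_gt0 _ _))// sqrtrM ?(ltW x1_gt0)// /V /f.
  move: x1_gt0; rewrite -sqrtr_gt0; move: (Num.sqrt _) => r1 r1_gt0.
  move: x2_gt0; rewrite -sqrtr_gt0; move: (Num.sqrt _) => r2 r2_gt0.
  move: x3_gt0; rewrite -sqrtr_gt0; move: (Num.sqrt _) => r3 r3_gt0.
  have := den0 t.
  move: (sin t) (cos t) C0 => s c c_gt0 d_gt0.
  field.
  by rewrite !gt_eqF.
pose h (t : R) := (1 - e / b ^+ 2 * sin t ^+ 2) * V t.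
have cV : continuous V.
  move=> t; apply: cvgM; last exact: continuous_invsqrt_sin2.
  by apply: cvgM; exact: continuous_invsqrt_sin2.
have ch : continuous h.
  move=> t; apply: cvgM; last exact: cV.
  apply: cvgB; first exact: cvg_cst.
  by apply: cvgM; [exact: cvg_cst | exact: continuous_sin2].
have -> : (\int[lebesgue_measure]_(t in `[0%R, (pi / 2)%R[) (G (F t) * f t)%:E =
    \int[lebesgue_measure]_(t in `[0%R, (pi / 2)%R])
      ((b ^+ 2 + e) / b ^+ 2 * h t)%:E)%E.
  rewrite -integral_itv_bndo_bndc; last first.
    apply/measurable_EFinP/measurable_funTS; apply: continuous_measurable_fun.
    by move=> t; apply: cvgM; [exact: cvg_cst | exact: ch].
  by apply: eq_integral => t; rewrite inE/= => /GF ->.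
rewrite -[fine _ in LHS]/(\int[lebesgue_measure]_(t in `[0, pi / 2])
  ((b ^+ 2 + e) / b ^+ 2 * h t)).
rewrite RintegralZl//; last exact: continuous_integrable_itvcc.
have c1 : b ^+ 2 / (b ^+ 2 + e) * ((b ^+ 2 + e) / b ^+ 2) = 1.
  by field; rewrite !gt_eqF.
by rewrite mulrA c1 mul1r.
Qed.

(** * The value of pi *)

Lemma invsqrt_sin2_ge1 (R : realType) (x t : R) : 0 <= x < 1 ->
  1 <= (Num.sqrt (1 - x * sin t ^+ 2))^-1.
Proof.
move=> x01; have /andP[xs0 xs1] := mul_sin2_itv01 R x t x01.
rewrite invf_ge1 ?sqrtr_gt0 ?subr_gt0//.
by rewrite -[leRHS]sqrtr1 ler_wsqrtr// lerBlDr lerDl.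
Qed.

Theorem theorem3p2 (R : realType) (a b : R) (ha : 1 < a) (hab : a < b) :
  pi =
  (b ^+ 2 / (b ^+ 2 + 1)
     * ellipticK (((a ^+ 2 + 1) * b) / ((b ^+ 2 + 1) * a))
   + b ^+ 2 / (b ^+ 2 - 1)
     * ellipticK (((a ^+ 2 - 1) * b) / ((b ^+ 2 - 1) * a)))
  / lauricellaFD (1 / 2) [tuple 1 / 2; 1 / 2; 1 / 2] 1
      [tuple a ^+ 2 / b ^+ 2; 1 / (a ^+ 2 * b ^+ 2); 1 / b ^+ 4].
Proof.
have [x1_itv x2_itv x3_itv] := lauricella_args_itv01 _ _ _ ha hab.
set x := [tuple a ^+ 2 / b ^+ 2; _; _].
have -> : [tuple 1 / 2; 1 / 2; 1 / 2] = [tuple 1 / 2 : R | _ < 3].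
  by apply: eq_from_tnth => -[[|[|[|]]] //= i]; rewrite tnth_mktuple (tnth_nth 0).
have x01 j : 0 <= tnth x j < 1.
  by case: j => -[|[|[|]]] //= i; rewrite (tnth_nth 0).
pose V (t : R) := (Num.sqrt (1 - a ^+ 2 / b ^+ 2 * sin t ^+ 2))^-1 *
  (Num.sqrt (1 - 1 / (a ^+ 2 * b ^+ 2) * sin t ^+ 2))^-1 *
  (Num.sqrt (1 - 1 / b ^+ 4 * sin t ^+ 2))^-1.
have FDE : pi / 2 * lauricellaFD (1 / 2) [tuple 1 / 2 | _ < 3] 1 x =
    \int[lebesgue_measure]_(t in `[0, pi / 2]) V t.
  rewrite lauricellaFD_half//; apply: eq_Rintegral => t _.
  by rewrite !big_ord_recl big_ord0 !(tnth_nth 0)/= mulr1 -[RHS]mulrA.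
have cV : continuous V.
  move=> t; apply: cvgM; last exact: continuous_invsqrt_sin2.
  by apply: cvgM; exact: continuous_invsqrt_sin2.
have intV : lebesgue_measure.-integrable `[0, pi / 2]%classic (EFin \o V).
  exact: continuous_integrable_itvcc.
have int_e e : lebesgue_measure.-integrable `[0, pi / 2]%classic
    (EFin \o (fun t => (1 - e / b ^+ 2 * sin t ^+ 2) * V t)).
  apply: continuous_integrable_itvcc => t; apply: cvgM; last exact: cV.
  apply: cvgB; first exact: cvg_cst.
  by apply: cvgM; [exact: cvg_cst | exact: continuous_sin2].
rewrite !ellipticK_jacobi ?sqrrN ?expr1n// -RintegralD//.
have -> : \int[lebesgue_measure]_(t in `[0, pi / 2])
    ((1 - 1 / b ^+ 2 * sin t ^+ 2) * V t + (1 - -1 / b ^+ 2 * sin t ^+ 2) * V t) =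
    2 * \int[lebesgue_measure]_(t in `[0, pi / 2]) V t.
  by rewrite -RintegralZl//; apply: eq_Rintegral => t _; ring.
have V_gt0 : 0 < \int[lebesgue_measure]_(t in `[0, pi / 2]) V t.
  have pi2 : 0 < pi / 2 :> R by rewrite divr_gt0 ?pi_gt0.
  apply: (lt_le_trans pi2).
  have int1 : \int[lebesgue_measure]_(t in `[0, pi / 2 : R]) (1 : R) = pi / 2.
    rewrite Rintegral_cst// mul1r.
    have := lebesgue_measure_itv (`[0, pi / 2] : interval R).
    by rewrite /= lte_fin pi2 => ->; rewrite /= subr0.
  rewrite -[leLHS]int1; apply: le_Rintegral => //.
  - by apply: continuous_integrable_itvcc => t; exact: cvg_cst.
  - move=> t _; rewrite -[1]mulr1 -[X in X * _]mulr1.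
    by rewrite !ler_pM ?mulr_ge0// invsqrt_sin2_ge1.
move: V_gt0; rewrite -FDE; set L := lauricellaFD _ _ _ _ => L_gt0.
have L0 : L != 0 by apply: contraTneq L_gt0 => ->; rewrite mulr0 ltxx.
by field.
Qed.
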